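(* Let $n\ge2$, $S\subseteq[n]$ with $k=|S|$ and $1\le k\le n-1$, and let $\mathbf{1}_S(x)=\sum_{i\in S}x_i$. There is a bijection between the set of $\mathbf{1}_S$-monotone paths on the permutahedron $\Pi_{n-1}$ and $\mathfrak{S}_k\times\mathfrak{S}_{n-k}\times\mathrm{SYT}(k,n-k)$ such that a path is coherent if and only if its image lies in $\mathfrak{S}_k\times\mathfrak{S}_{n-k}\times\mathrm{rSYT}(k,n-k)$, i.e. the tableau component is realizable.
   Context: $\Pi_{n-1}=\mathrm{conv}\{(\sigma(1),\dots,\sigma(n)):\sigma\in\mathfrak{S}_n\}$, $\mathfrak{S}_m$ the symmetric group. For a polytope $P$ and linear $c$ not constant on $P$, let $P_{\min},P_{\max}$ be the faces minimizing/maximizing $c$. A $c$-monotone path is a sequence of vertices $v_0,\dots,v_m$ with $v_0\in P_{\min}$, $v_m\in P_{\max}$, each $[v_{i-1},v_i]$ an edge of $P$ and $\langle c,v_{i-1}\rangle<\langle c,v_i\rangle$. It is coherent if there is $w$ such that, with $\pi(x)=(\langle c,x\rangle,\langle w,x\rangle)$, the upper boundary $\{(s,t)\in\pi(P):(s,t+\epsilon)\notin\pi(P)\ \forall\epsilon>0\}$ of $\pi(P)$ is the union of the segments $\pi([v_{i-1},v_i])$ and $\{x\in P:\pi(x)\in\pi([v_{i-1},v_i])\}=[v_{i-1},v_i]$ for each $i$. $\mathrm{SYT}(a,b)$ is the set of standard Young tableaux of rectangular shape $a\times b$ (entries $1,\dots,ab$, increasing along rows and columns). Such a tableau is realizable if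 there are $u_1<\cdots<u_a$ and $v_1<\cdots<v_b$ with all $u_i+v_j$ distinct such that the tableau is obtained from the matrix $(u_i+v_j)$ by replacing each entry by its rank among all entries; $\mathrm{rSYT}(a,b)$ denotes the realizable ones. *)

(* Defs.v *)
From mathcomp Require Export all_boot all_order all_algebra all_fingroup.
From mathcomp Require Export classical_sets functions reals.

Set Implicit Arguments.
Unset Strict Implicit.
Unset Printing Implicit Defensive.

Import Order.TTheory GRing.Theory Num.Theory.

Local Open Scope classical_set_scope.
Local Open Scope ring_scope.

Section Polytopes.
Variables (R : realType) (n : nat).
Implicit Types (P F A : set 'rV[R]_n) (c w x y u v : 'rV[R]_n).

Definition dot c x : R := \sum_(i < n) c 0 i * x 0 i.

Definition conv A : set 'rV[R]_n :=
  [set x | exists (m : nat) (p : 'I_m -> 'rV[R]_n) (t : 'I_m -> R),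
     [/\ forall j, A (p j), forall j, 0 <= t j, \sum_j t j = 1
       & x = \sum_j t j *: p j]].

Definition segment u v : set 'rV[R]_n :=
  [set x | exists t : R, 0 <= t <= 1 /\ x = (1 - t) *: u + t *: v].

(* A face is cut out by an inequality that is valid on all of P. *)
Definition face P F : Prop :=
  exists (a : 'rV[R]_n) (b : R),
    (forall x, P x -> dot a x <= b) /\ F = [set x | P x /\ dot a x = b].

Definition vertex P v : Prop := face P [set v].

Definition edge P u v : Prop := u <> v /\ face P (segment u v).

Definition minface P c : set 'rV[R]_n :=
  [set x | P x /\ forall y, P y -> dot c x <= dot c y].

Definition maxface P c : set 'rV[R]_n :=
  [set x | P x /\ forall y, P y -> dot c y <= dot c x].

(* A path v_0, ..., v_m is the sequence p of size m + 1 with v_i = nth 0 p i;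
   the indices of its steps [v_i, v_{i+1}] are those with i.+1 < size p. *)
Definition monotone_path P c (p : seq 'rV[R]_n) : Prop :=
  [/\ (0 < size p)%N,
      forall i, (i < size p)%N -> vertex P (nth 0 p i),
      minface P c (nth 0 p 0%N),
      maxface P c (nth 0 p (size p).-1)
    & forall i, (i.+1 < size p)%N ->
        edge P (nth 0 p i) (nth 0 p i.+1) /\
        dot c (nth 0 p i) < dot c (nth 0 p i.+1)].

Definition plane_proj c w x : R * R := (dot c x, dot w x).

Definition upper_boundary (Q : set (R * R)) : set (R * R) :=
  [set st | Q st /\ forall e : R, 0 < e -> ~ Q (st.1, st.2 + e)].

Definition coherent P c (p : seq 'rV[R]_n) : Prop :=
  exists w : 'rV[R]_n,
    upper_boundary (plane_proj c w @` P) =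
      \bigcup_(i in [set i | (i.+1 < size p)%N])
        (plane_proj c w @` segment (nth 0 p i) (nth 0 p i.+1)) /\
    forall i, (i.+1 < size p)%N ->
      [set x | P x /\
        (plane_proj c w @` segment (nth 0 p i) (nth 0 p i.+1))
          (plane_proj c w x)]
      = segment (nth 0 p i) (nth 0 p i.+1).

(* 'S_n acts on {0, ..., n-1}, hence the shift by one. *)
Definition permutahedron : set 'rV[R]_n :=
  conv (range (fun s : 'S_n => \row_(i < n) ((s i).+1)%:R : 'rV[R]_n)).

Definition indicator (S : {set 'I_n}) : 'rV[R]_n := \row_(i < n) (i \in S)%:R.

End Polytopes.

Definition SYT (a b : nat) : set 'M[nat]_(a, b) :=
  [set T : 'M[nat]_(a, b) |
    [/\ perm_eq [seq T q.1 q.2 | q : 'I_a * 'I_b] (iota 1 (a * b)%N),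
      forall i (j j' : 'I_b), (j < j')%N -> (T i j < T i j')%N
    & forall (i i' : 'I_a) j, (i < i')%N -> (T i j < T i' j)%N]].

Definition realizable (R : realType) (a b : nat) (T : 'M[nat]_(a, b)) : Prop :=
  exists (u : 'I_a -> R) (v : 'I_b -> R),
    [/\ forall i i' : 'I_a, (i < i')%N -> u i < u i',
        forall j j' : 'I_b, (j < j')%N -> v j < v j',
        injective (fun q : 'I_a * 'I_b => u q.1 + v q.2)
      & forall i j,
          T i j = #|[pred q : 'I_a * 'I_b | u q.1 + v q.2 <= u i + v j]|].

Definition rSYT (R : realType) (a b : nat) : set 'M[nat]_(a, b) :=
  @SYT a b `&` [set T | realizable R T].

Arguments SYT : clear implicits.
Arguments rSYT : clear implicits.
Arguments permutahedron : clear implicits.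

(* Main.v *)
(* A permutation s maximizes a linear functional a over the vertices of the
   permutahedron iff s sorts a weakly; hence edges are the swaps of two adjacent
   values, and a monotone path starts with S below its complement, ends with S
   above it, and each step lets one x in S jump over one y outside S.  The path
   is thus determined by the initial orders of S and of its complement together
   with the times T(i, j) at which the i-th largest element of S passes the j-th
   smallest element of the complement; such T are exactly the standard tableaux.

   If w makes the path coherent, the lifted path is strictly concave, its slope
   at time T(i, j) being w_x - w_y, so T ranks the sums (- w_x) + w_y.
   Conversely, if T ranks the sums u_i + v_j, put w_x = - u_i and w_y = v_j; then
   the functional w + (u_i + v_j) 1_S has exactly one tie, and its face is the
   edge of the path at time T(i, j). *)

Require Import Defs.
From mathcomp Require Import boolp zify ring lra.

Set Implicit Arguments.
Unset Strict Implicit.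
Unset Printing Implicit Defensive.

Import Order.TTheory GRing.Theory Num.Theory.

Local Open Scope classical_set_scope.
Local Open Scope ring_scope.

(** * Permutations as strict total orders *)

Section PermOrder.
Variable n : nat.
Implicit Types s r t : 'S_n.

Lemma perm_card_lt s x : s x = #|[pred z | (s z < s x)%N]| :> nat.
Proof.
rewrite -sum1_card (reindex_inj (@perm_inj _ (s^-1)%g)) /=.
under eq_bigl do rewrite inE permKV.
rewrite -(big_ord_widen n (fun=> 1%N) (ltnW (ltn_ord (s x)))).
by rewrite sum1_card card_ord.
Qed.

(** Each value counts its predecessors, and one implication between two strict total orders already
    makes them equal. *)
Lemma perm_eq_lt s r :
  (forall x y, (s x < s y)%N -> (r x < r y)%N) -> s = r.
Proof.
move=> sr; apply/permP => x; apply: val_inj.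
rewrite /= perm_card_lt [RHS]perm_card_lt.
apply: eq_card => z; rewrite !inE; apply/idP/idP; first exact: sr.
move=> rzx; case: (ltngtP (s z) (s x)) => // [/sr|]; first by lia.
by move=> /val_inj /perm_inj zx; rewrite zx ltnn in rzx.
Qed.

(** Counting predecessors is injective for a strict total order. The explicit count is kept because
    [label_path] is written with it. *)
Lemma rank_perm (lt : rel 'I_n) :
    irreflexive lt -> transitive lt ->
    (forall x y, x != y -> lt x y || lt y x) ->
  exists s : 'S_n, (forall x, s x = #|[pred z | lt z x]| :> nat) /\
    forall x y, (s x < s y)%N = lt x y.
Proof.
move=> ltxx lt_tr lt_tot.
have rlt x : (#|[pred z | lt z x]| < n)%N.
  rewrite -[X in (_ < X)%N]card_ord; apply: proper_card; apply/fintype.properP.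
  by split; [apply/fintype.subsetP => z | exists x]; rewrite ?inE // ltxx.
pose r x := Ordinal (rlt x).
have rP x y : lt x y -> (r x < r y)%N.
  move=> xy; apply: proper_card; apply/fintype.properP; split.
    by apply/fintype.subsetP => z; rewrite !inE => /lt_tr; apply.
  by exists x; rewrite !inE ?ltxx.
have r_inj : injective r.
  move=> x y rxy; apply/eqP; apply: contraT => /lt_tot /orP[] /rP;
  by rewrite rxy ltnn.
exists (perm r_inj); split=> [x|x y]; rewrite !permE //.
apply/idP/idP => [|/rP//]; case: (eqVneq x y) => [->|/lt_tot/orP[//|/rP]].
  by rewrite ltnn.
by move=> /= + +; lia.
Qed.

Lemma swap_val s x y z : s y = (s x).+1 :> nat ->
  (tperm x y * s)%g z =
    (if z == x then s y else if z == y then s x else s z) :> nat.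
Proof.
move=> sxy; rewrite permM.
case: tpermP => [->|->|/eqP/negPf-> /eqP/negPf->]; rewrite ?eqxx //.
by case: eqP => // ->.
Qed.

(** The values at [x] and [y] are consecutive, so no third value lies between them. *)
Lemma swap_lt s x y z z' : s y = (s x).+1 :> nat ->
    ~~ ((z == x) && (z' == y)) -> ~~ ((z == y) && (z' == x)) ->
  ((tperm x y * s)%g z < (tperm x y * s)%g z')%N = (s z < s z')%N.
Proof.
move=> sxy; rewrite !swap_val //.
have sE a b : (a == b) = (s a == s b :> nat).
  by apply/eqP/eqP => [->//|/val_inj/perm_inj].
rewrite !sE; do ![case: ifPn => /eqP ?]; lia.
Qed.

Lemma adjacent_lt s (r : 'I_n -> 'I_n) :
    (forall x y, s y = (s x).+1 :> nat -> (r x < r y)%N) ->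
  forall x y, (s x < s y)%N -> (r x < r y)%N.
Proof.
move=> adj x y; move: {2}(s y - s x)%N (erefl (s y - s x)%N) => d.
elim: d y => [|d IHd] y dE xy; first by lia.
case: d IHd dE => [|d] IHd dE; first by apply: adj; lia.
have lt_n : (s x + d.+1 < n)%N by have := ltn_ord (s y); lia.
(* [y'] carries the value just below that of [y]. *)
pose y' := (s^-1)%g (Ordinal lt_n).
have sy' : s y' = (s x + d.+1)%N :> nat by rewrite permKV.
apply: (@ltn_trans (r y')); first by apply: IHd; rewrite sy'; lia.
by apply: adj; rewrite sy'; lia.
Qed.

End PermOrder.

(** * Linear functionals on the permutahedron *)

Section Permutahedron.
Variables (R : realType) (n : nat).
Implicit Types (a c w x y : 'rV[R]_n) (s r t : 'S_n) (q : 'S_n -> R).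

Local Notation P := (permutahedron R n).

Definition pvec s : 'rV[R]_n := \row_i (s i).+1%:R.

Lemma pvec_inj : injective pvec.
Proof.
move=> s t /rowP st; apply/permP => i; apply: val_inj.
by have /eqP := st i; rewrite !mxE eqr_nat eqSS => /eqP.
Qed.

Lemma dotDl a c x : dot (a + c) x = dot a x + dot c x.
Proof. by rewrite -big_split; apply: eq_bigr => i _; rewrite mxE mulrDl. Qed.

Lemma dotDr a x y : dot a (x + y) = dot a x + dot a y.
Proof. by rewrite -big_split; apply: eq_bigr => i _; rewrite mxE mulrDr. Qed.

Lemma dotZl l a x : dot (l *: a) x = l * dot a x.
Proof. by rewrite mulr_sumr; apply: eq_bigr => i _; rewrite mxE mulrA. Qed.

Lemma dotZr l a x : dot a (l *: x) = l * dot a x.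
Proof. by rewrite mulr_sumr; apply: eq_bigr => i _; rewrite mxE mulrCA. Qed.

Lemma dotNl a x : dot (- a) x = - dot a x.
Proof. by rewrite -scaleN1r dotZl mulN1r. Qed.

Lemma dot_sumr (I : finType) (Q : pred I) a (F : I -> 'rV[R]_n) :
  dot a (\sum_(i | Q i) F i) = \sum_(i | Q i) dot a (F i).
Proof.
elim/big_rec2: _ => [|i y x _ <-]; last by rewrite dotDr.
by rewrite /dot big1 // => i _; rewrite mxE mulr0.
Qed.

(** Adding up the weights of equal points leaves one coefficient per permutation, so that supports
    make sense. *)
Lemma permutahedronP x : P x <-> exists q,
  [/\ forall s, 0 <= q s, \sum_s q s = 1 & x = \sum_s q s *: pvec s].
Proof.
split=> [[m [p [t [Pp t0 t1 ->]]]]|[q [q0 q1 ->]]].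
  have /choice[sg psg] j : exists s, pvec s = p j.
    by have [s _ <-] := Pp j; exists s.
  exists (fun s => \sum_(j | sg j == s) t j); split.
  - by move=> s; apply: sumr_ge0.
  - by rewrite -t1 [RHS](partition_big sg xpredT).
  rewrite (partition_big sg xpredT) //=; apply: eq_bigr => s _.
  rewrite scaler_suml; apply: eq_bigr => j /eqP <-.
  by rewrite psg.
exists #|{perm 'I_n}|, (fun j => pvec (enum_val j)), (fun j => q (enum_val j)).
split=> //.
  by rewrite -q1 -(big_enum_val q).
by rewrite -(big_enum_val (fun s => q s *: pvec s)).
Qed.

Lemma permutahedron_pvec s : P (pvec s).
Proof.
apply/permutahedronP; exists (fun r => (r == s)%:R); split=> //.
  by rewrite (bigD1 s) //= eqxx big1 ?addr0 // => r /negPf ->.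
rewrite (bigD1 s) //= eqxx scale1r big1 ?addr0 // => r /negPf ->.
by rewrite scale0r.
Qed.

Lemma segment_permutahedron x y : P x -> P y -> segment x y `<=` P.
Proof.
move=> /permutahedronP[q [q0 q1 ->]] /permutahedronP[p [p0 p1 ->]] z.
move=> [l [/andP[l0 l1] ->]]; apply/permutahedronP.
exists (fun s => (1 - l) * q s + l * p s); split.
- by move=> s; rewrite addr_ge0 ?mulr_ge0 ?subr_ge0.
- by rewrite big_split -!mulr_sumr q1 p1 /= !mulr1 subrK.
rewrite !scaler_sumr -big_split /=. apply: eq_bigr => s _.
by rewrite [RHS]scalerDl !scalerA.
Qed.

Lemma dot_le_permutahedron a b :
  (forall s, dot a (pvec s) <= b) -> forall x, P x -> dot a x <= b.
Proof.
move=> ab _ /permutahedronP[q [q0 q1 ->]].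
rewrite dot_sumr -[b]mul1r -q1 mulr_suml; apply: ler_sum => s _.
by rewrite dotZr ler_wpM2l.
Qed.

(** The slacks [b - dot a (pvec r)] are nonnegative and their [q]-weighted sum is zero, so each
    weighted slack vanishes. *)
Lemma dot_eq_support a b q x :
    (forall s, dot a (pvec s) <= b) ->
    (forall s, 0 <= q s) -> \sum_s q s = 1 -> x = \sum_s q s *: pvec s ->
    dot a x = b ->
  forall s, q s != 0 -> dot a (pvec s) = b.
Proof.
move=> ab q0 q1 -> axb s qs.
have /psumr_eq0P H : forall r, true -> 0 <= q r * (b - dot a (pvec r)).
  by move=> r _; rewrite mulr_ge0 ?subr_ge0.
have /eqP : q s * (b - dot a (pvec s)) = 0.
  apply: H => //; under eq_bigr do rewrite mulrBr -dotZr.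
  by rewrite sumrB -mulr_suml q1 mul1r -dot_sumr axb subrr.
by rewrite mulf_eq0 (negPf qs) subr_eq0 => /eqP.
Qed.

(** Ties of [a] leave [s] free; these are the permutations whose vertices maximize [a]. *)
Definition sorted_by a s := forall x y : 'I_n, a 0 x < a 0 y -> (s x < s y)%N.

Lemma pvec_swap s (x y : 'I_n) :
  pvec (tperm x y * s)%g = pvec s +
    ((s y)%:R - (s x)%:R) *: (delta_mx 0 x - delta_mx 0 y).
Proof.
apply/rowP => z; rewrite !mxE eqxx /= permM.
case: tpermP => [->|->|/eqP/negPf-> /eqP/negPf->]; rewrite ?eqxx -!natr1.
- by case: (eqVneq x y) => [->|_] /=; ring.
- by case: (eqVneq y x) => [->|_] /=; ring.
by ring.
Qed.

Lemma dot_delta a (x : 'I_n) : dot a (delta_mx 0 x) = a 0 x.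
Proof.
rewrite /dot (bigD1 x) //= mxE !eqxx mulr1 big1 ?addr0 // => y /negPf yx.
by rewrite mxE yx andbF mulr0.
Qed.

Lemma dot_swap a s (x y : 'I_n) :
  dot a (pvec (tperm x y * s)%g) =
  dot a (pvec s) + (a 0 x - a 0 y) * ((s y)%:R - (s x)%:R).
Proof.
rewrite pvec_swap dotDr dotZr dotDr -scaleN1r dotZr !dot_delta.
by ring.
Qed.

(** Exchange argument: swapping two values ordered against [a] would increase the functional. *)
Lemma max_sorted a s :
  (forall r, dot a (pvec r) <= dot a (pvec s)) -> sorted_by a s.
Proof.
move=> smax x y axy; have := smax (tperm x y * s)%g.
rewrite dot_swap gerDl nmulr_rle0 ?subr_lt0 // subr_ge0 ler_nat leq_eqVlt.
by case/predU1P => // /val_inj /perm_inj xy; rewrite xy ltxx in axy.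
Qed.

Let pair_term a s (x z : 'I_n) : R :=
  a 0 x * (s z <= s x)%:R + a 0 z * (s x <= s z)%:R.

(* Writing [s x + 1] as the number of [z] with [s z <= s x] turns [dot] into a
   sum over pairs, which [s] can maximize pair by pair. *)
Lemma dot_pairs a s :
  dot a (pvec s) *+ 2 = \sum_x \sum_z pair_term a s x z.
Proof.
have dotE : dot a (pvec s) = \sum_x \sum_z a 0 x * (s z <= s x)%:R.
  apply: eq_bigr => x _; rewrite mxE -mulr_sumr -natr_sum; congr (_ * _%:R).
  rewrite [in LHS]perm_card_lt (bigD1 x) //= leqnn add1n -sum1_card big_mkcond /=.
  congr _.+1; rewrite (bigD1 x) //= inE ltnn add0n; apply: eq_bigr => z zx.
  rewrite inE ltn_neqAle; case: eqP => [/val_inj/perm_inj|] /=; last by case: leq.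
  by move=> e; rewrite e eqxx in zx.
rewrite mulr2n {1}dotE [X in _ + X]dotE [X in _ + X]exchange_big -big_split.
by apply: eq_bigr => x _; rewrite -big_split.
Qed.

(** For distinct [x] and [z] a pair term is one of [a 0 x] and [a 0 z], namely the one at the larger
    value of the permutation; a sorted permutation always picks the larger. *)
Lemma pair_term_le a s r : sorted_by a s ->
  forall x z : 'I_n, pair_term a r x z <= pair_term a s x z.
Proof.
move=> sa x z; rewrite /pair_term.
case: (eqVneq x z) => [->|xz]; first by rewrite !leqnn.
have neq t : (t z <= t x)%N = ~~ (t x <= t z)%N.
  rewrite -ltnNge ltn_neqAle; case: eqP => // /val_inj /perm_inj zx.
  by rewrite zx eqxx in xz.
rewrite !neq; case: (ltgtP (a 0 x) (a 0 z)) => [axz|azx|->].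
- have /ltnW -> := sa _ _ axz; case: leq => /=; lra.
- have := sa _ _ azx; rewrite ltnNge => /negPf ->; case: leq => /=; lra.
by do 2!case: leq => /=; lra.
Qed.

Lemma sorted_max a s : sorted_by a s ->
  forall r, dot a (pvec r) <= dot a (pvec s).
Proof.
move=> sa r; rewrite -(@ler_pMn2r _ 2) // !dot_pairs.
by do 2![apply: ler_sum => ? _]; apply: pair_term_le.
Qed.

Lemma sorted_max_eq a s r : sorted_by a s ->
  dot a (pvec r) = dot a (pvec s) -> sorted_by a r.
Proof.
by move=> sa rs; apply: max_sorted => t; rewrite rs; apply: sorted_max.
Qed.

Lemma sorted_maxP a s :
  (forall x, P x -> dot a x <= dot a (pvec s)) <-> sorted_by a s.
Proof.
split=> [smax|sa]; first by apply: max_sorted => r; apply/smax/permutahedron_pvec.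
exact/dot_le_permutahedron/sorted_max.
Qed.

Lemma pvec_sorted s r : sorted_by (pvec s) r -> r = s.
Proof.
move=> sr; apply/esym/perm_eq_lt => x y sxy; apply: sr.
by rewrite !mxE ltr_nat.
Qed.

Lemma sorted_pvec s : sorted_by (pvec s) s.
Proof. by move=> x y; rewrite !mxE ltr_nat. Qed.

(** A maximizer puts weight only on maximizing vertices, hence on [s] and [t]. The case [s = t] is
    included and serves for vertices. *)
Lemma exposed_segment a s t : sorted_by a s -> sorted_by a t ->
    (forall r, sorted_by a r -> r = s \/ r = t) ->
  [set x | P x /\ dot a x = dot a (pvec s)] = segment (pvec s) (pvec t).
Proof.
move=> sa ta only; have ts : dot a (pvec t) = dot a (pvec s).
  by apply/eqP; rewrite eq_le !sorted_max.
apply/seteqP; split=> [x [/permutahedronP[q [q0 q1 xE]] axs]|x]; last first.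
  move=> xst; split.
    by apply: segment_permutahedron xst; apply: permutahedron_pvec.
  by case: xst => l [_ ->]; rewrite dotDr !dotZr ts; ring.
have supp := dot_eq_support (sorted_max sa) q0 q1 xE axs.
have qD1 : 1 - q s = \sum_(r | r != s) q r.
  by rewrite -q1 (bigD1 s) //= addrAC subrr add0r.
(* The parameter is the total weight off [s], all of it carried by [t]. *)
exists (1 - q s); split.
  by rewrite {1}qD1 sumr_ge0 //= gerBl.
rewrite xE (bigD1 s) //= subKr qD1 scaler_suml; congr (_ + _).
apply: eq_bigr => r rs; have [->|qr] := eqVneq (q r) 0; first by rewrite !scale0r.
case: (only r) => [|/eqP|->//]; last by rewrite (negPf rs).
exact/(sorted_max_eq sa)/supp.
Qed.

(** * Vertices and edges of the permutahedron *)

Lemma segment_xx x : segment x x = [set x].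
Proof.
apply/seteqP; split=> [y [l [_ ->]]|y ->] /=.
  by rewrite -scalerDl subrK scale1r.
by exists 0; rewrite lexx ler01 scale0r subr0 scale1r addr0.
Qed.

Lemma segment_l x y : segment x y x.
Proof. by exists 0; rewrite lexx ler01 scale0r subr0 scale1r addr0. Qed.

Lemma segment_r x y : segment x y y.
Proof. by exists 1; rewrite lexx ler01 subrr scale0r scale1r add0r. Qed.

(** Among the vertices, the functional [pvec r] is maximal at [pvec r] alone, so no two other
    vertices can average to it. *)
Lemma pvec_segment r s t : segment (pvec s) (pvec t) (pvec r) -> r = s \/ r = t.
Proof.
move=> [l [/andP[l0 l1] rE]].
have neq u : u != r -> dot (pvec r) (pvec u) < dot (pvec r) (pvec r).
  move=> ur; rewrite lt_neqAle sorted_max ?andbT; last exact: sorted_pvec.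
  apply: contra ur => /eqP /(sorted_max_eq (@sorted_pvec r)) ru.
  by rewrite (pvec_sorted ru).
case: (eqVneq s r) => [->|/neq sr]; first by left.
case: (eqVneq t r) => [->|/neq tr]; first by right.
have := congr1 (dot (pvec r)) rE; rewrite dotDr !dotZr => E.
suff : dot (pvec r) (pvec r) < dot (pvec r) (pvec r) by rewrite ltxx.
rewrite {1}E.
set d := dot _ (pvec r) in E sr tr *; set ds := dot _ (pvec s) in E sr *.
set dt := dot _ (pvec t) in E tr *.
have : 0 <= (1 - l) * (d - ds) by rewrite mulr_ge0 ?subr_ge0 // ltW.
have : 0 <= l * (d - dt) by rewrite mulr_ge0 ?subr_ge0 // ltW.
move: l0; rewrite le_eqVlt => /predU1P[<-|l0]; first by lra.
have : 0 < l * (d - dt) by rewrite mulr_gt0 ?subr_gt0.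
by lra.
Qed.

Lemma vertexP v : vertex P v <-> exists s, v = pvec s.
Proof.
split=> [[a [b [ab vE]]]|[s ->]]; last first.
  exists (pvec s), (dot (pvec s) (pvec s)); split.
    exact/sorted_maxP/sorted_pvec.
  rewrite (@exposed_segment _ s s) ?segment_xx //; try exact: sorted_pvec.
  by move=> r /pvec_sorted; left.
have [/permutahedronP[q [q0 q1 xE]] avb] : [set x | P x /\ dot a x = b] v.
  by rewrite -vE.
have ab' s : dot a (pvec s) <= b by apply/ab/permutahedron_pvec.
(* The weights sum to 1. A permutation of nonzero weight lies on the exposed face, which is the
   single point [v]. *)
have [s qs] : exists s, q s != 0.
  apply/existsP; apply: contraT; rewrite negb_exists => /forallP q00.
  move: q1; rewrite big1 => [/esym/eqP|s _]; first by rewrite oner_eq0.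
  by apply/eqP; have := q00 s; rewrite negbK.
exists s; have : [set v] (pvec s); last by [].
rewrite vE; split; first exact: permutahedron_pvec.
exact: dot_eq_support avb _ qs.
Qed.

(* Only [x] and [y], adjacent for [s], are tied by [a]: the face of [a] is
   the edge that swaps them. *)
Lemma swap_face a s (x y : 'I_n) : s y = (s x).+1 :> nat -> a 0 x = a 0 y ->
    (forall z z', (s z < s z')%N -> a 0 z < a 0 z' \/ z = x /\ z' = y) ->
  sorted_by a s /\
  [set z | P z /\ dot a z = dot a (pvec s)] =
    segment (pvec s) (pvec (tperm x y * s)%g).
Proof.
move=> sxy axy strict; set t := (tperm x y * s)%g.
have sa : sorted_by a s.
  move=> z z' azz'; rewrite ltnNge leq_eqVlt; apply/negP.
  move=> /predU1P[/val_inj/perm_inj zz'|/strict[|[e e']]].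
  - by rewrite zz' ltxx in azz'.
  - by move=> /(lt_trans azz'); rewrite ltxx.
  by rewrite e e' axy ltxx in azz'.
have ta : sorted_by a t.
  by apply: (sorted_max_eq sa); rewrite dot_swap axy subrr mul0r addr0.
split=> //; apply: exposed_segment => // r ra.
have xy : x != y by apply/eqP => xy; rewrite xy in sxy; lia.
(* A sorted [r] can only choose the order of the tied pair: one choice is [s], the other [t]. *)
case: (ltngtP (r x) (r y)) => [rxy|ryx|/val_inj/perm_inj/eqP].
- left; apply/esym/perm_eq_lt => z z' /strict[/ra//|[-> ->//]].
- right; apply/esym/perm_eq_lt => z z'.
  case: (boolP ((z == y) && (z' == x))) => [/andP[/eqP-> /eqP->//]|n1].
  case: (boolP ((z == x) && (z' == y))) => [/andP[/eqP-> /eqP->]|n2].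
    by rewrite !swap_val // !eqxx eq_sym (negPf xy); lia.
  rewrite swap_lt // => /strict[/ra//|[ex ey]].
  by rewrite ex ey !eqxx in n2.
by rewrite (negPf xy).
Qed.

(** The sum of the two endpoints is an exposing functional: it ties [x] with [y], and the endpoints
    agree on every other comparison. *)
Lemma edge_swap s (x y : 'I_n) : s y = (s x).+1 :> nat ->
  edge P (pvec s) (pvec (tperm x y * s)%g).
Proof.
move=> sxy; split.
  move=> /pvec_inj /permP /(_ x) /(congr1 val) /=.
  by rewrite swap_val // eqxx; lia.
set t := (tperm x y * s)%g; pose a := pvec s + pvec t.
have aE z : a 0 z = ((s z).+1 + (t z).+1)%:R by rewrite !mxE natrD.
have xy : x != y by apply/eqP => xy; rewrite xy in sxy; lia.
have [||sa <-] := @swap_face a s x y sxy.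
- by rewrite !aE !swap_val // !eqxx [y == x]eq_sym (negPf xy); congr _%:R; lia.
- move=> z z' zz'; rewrite !aE ltr_nat.
  case: (boolP ((z == x) && (z' == y))) => [/andP[/eqP-> /eqP->]|n1].
    by right.
  left; suff : (t z < t z')%N by lia.
  rewrite swap_lt //; apply/negP => /andP[/eqP e /eqP e'].
  by rewrite e e' in zz'; lia.
by exists a, (dot a (pvec s)); split=> //; apply/sorted_maxP.
Qed.

(** If the exposing functional ties two elements adjacent for [s], swapping them stays on the edge
    and so gives [t]. Without such a tie it increases strictly along [s], which forces [t = s]. *)
Lemma edge_pvec s t : edge P (pvec s) (pvec t) ->
  exists x y : 'I_n, s y = (s x).+1 :> nat /\ t = (tperm x y * s)%g.
Proof.
move=> [st [a [b [ab stE]]]].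
have [Ps asb] : [set x | P x /\ dot a x = b] (pvec s).
  by rewrite -stE; exact: segment_l.
have [Pt atb] : [set x | P x /\ dot a x = b] (pvec t).
  by rewrite -stE; exact: segment_r.
have sa : sorted_by a s by apply/sorted_maxP; rewrite asb.
have ta : sorted_by a t by apply/sorted_maxP; rewrite atb.
have [/existsP[x /existsP[y /andP[/eqP sxy /eqP axy]]]|noex] :=
  boolP [exists x : 'I_n, exists y : 'I_n,
    (s y == (s x).+1 :> nat) && (a 0 x == a 0 y)].
  exists x, y; split=> //.
  have : segment (pvec s) (pvec t) (pvec (tperm x y * s)%g).
    rewrite stE; split; first exact: permutahedron_pvec.
    by rewrite dot_swap axy subrr mul0r addr0.
  case/pvec_segment => [/permP/(_ x)/(congr1 val) /=|//].
  by rewrite swap_val // eqxx; lia.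
case: st; congr pvec; apply: perm_eq_lt; apply: adjacent_lt => x y sxy.
apply: ta; rewrite lt_neqAle; apply/andP; split.
  move: noex; rewrite negb_exists => /forallP/(_ x).
  by rewrite negb_exists => /forallP/(_ y); rewrite sxy eqxx.
by rewrite leNgt; apply/negP => /sa; lia.
Qed.

End Permutahedron.

(** * Monotone paths as sequences of adjacent swaps *)

Section MonotonePaths.
Variables (R : realType) (n : nat) (S : {set 'I_n}).
Implicit Types (s t : 'S_n) (sg : nat -> 'S_n).

Local Notation P := (permutahedron R n).
Local Notation c := (indicator R S).
Local Notation X := (@pvec R n).

Lemma minface_pvec s : minface P c (X s) <->
  forall x y, x \in S -> y \notin S -> (s x < s y)%N.
Proof.
have -> : minface P c (X s) <-> forall z, P z -> dot (- c) z <= dot (- c) (X s).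
  split=> [[_ H] z /H|H]; first by rewrite !dotNl lerN2.
  split; first exact: permutahedron_pvec.
  by move=> z /H; rewrite !dotNl lerN2.
rewrite sorted_maxP; split=> [sc x y xS yS|H x y].
  by apply: sc; rewrite !mxE xS (negPf yS) ltrN2.
rewrite !mxE ltrN2 ltr_nat => /= xy; apply: H.
  by move: xy; case: (y \in S); case: (x \in S).
by move: xy; case: (y \in S); case: (x \in S).
Qed.

Lemma maxface_pvec s : maxface P c (X s) <->
  forall x y, x \in S -> y \notin S -> (s y < s x)%N.
Proof.
have -> : maxface P c (X s) <-> forall z, P z -> dot c z <= dot c (X s).
  by split=> [[]//|H]; split=> //; exact: permutahedron_pvec.
rewrite sorted_maxP; split=> [sc x y xS yS|H y x].
  by apply: sc; rewrite !mxE xS (negPf yS).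
rewrite !mxE ltr_nat => xy; apply: H.
  by move: xy; case: (x \in S); case: (y \in S).
by move: xy; case: (y \in S); case: (x \in S).
Qed.

Definition swap_step s t := exists x y,
  [/\ x \in S, y \notin S, s y = (s x).+1 :> nat & t = (tperm x y * s)%g].

(** This makes the index of a path vertex its height above the start. *)
Lemma swap_step_dot s t : swap_step s t -> dot c (X t) = dot c (X s) + 1.
Proof.
move=> [x [y [xS yS sxy ->]]].
by rewrite dot_swap !mxE xS (negPf yS) sxy -natr1 /=; ring.
Qed.

Definition perm_path m sg :=
  [/\ forall x y, x \in S -> y \notin S -> (sg 0%N x < sg 0%N y)%N,
      forall x y, x \in S -> y \notin S -> (sg m y < sg m x)%N
    & forall i, (i < m)%N -> swap_step (sg i) (sg i.+1)].

(** An edge swaps two adjacent values; the increase of [c] forces the element moving up to be in [S]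
    and the other one outside. *)
Lemma monotone_pathP p : monotone_path P c p <->
  exists m sg, p = mkseq (X \o sg) m.+1 /\ perm_path m sg.
Proof.
split=> [[p0 pv pmin pmax pe]|[m [sg [-> [sg0 sgm sgS]]]]]; last first.
  have E i : (i <= m)%N -> nth 0 (mkseq (X \o sg) m.+1) i = X (sg i).
    by move=> im; rewrite nth_mkseq.
  rewrite /monotone_path size_mkseq succnK !E //; split=> //.
  - by move=> i im; rewrite E //; apply/vertexP; exists (sg i).
  - exact/minface_pvec.
  - exact/maxface_pvec.
  move=> i; rewrite ltnS => im; rewrite (E i (ltnW im)) (E _ im).
  rewrite (swap_step_dot (sgS i im)) ltrDl ltr01; split; last by [].
  by have [x [y [_ _ sxy ->]]] := sgS i im; apply: edge_swap.
have /choice[sg sgE] i : exists s, (i < size p)%N -> nth 0 p i = X s.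
  case: (ltnP i (size p)) => [/pv/vertexP[s ->]|_]; first by exists s.
  (* An arbitrary value past the end of [p]. *)
  by exists 1%g.
exists (size p).-1, sg; rewrite prednK //; split.
  apply: (@eq_from_nth _ 0) => [|i ip]; first by rewrite size_mkseq.
  by rewrite nth_mkseq // sgE.
split=> [||i ip].
- by apply/minface_pvec; rewrite -sgE.
- by apply/maxface_pvec; rewrite -sgE // prednK.
have ip1 : (i.+1 < size p)%N by lia.
have := pe i ip1; rewrite !sgE // 1?ltnW // => -[/edge_pvec[x [y [sxy ->]]]].
rewrite dot_swap sxy ltrDl -natr1 addrAC subrr add0r mulr1 subr_gt0 !mxE.
rewrite ltr_nat => yx; exists x, y; split=> //.
  by move: yx; case: (x \in S); case: (y \in S).
by move: yx; case: (x \in S); case: (y \in S).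
Qed.

Lemma perm_path_dot m sg : perm_path m sg ->
  forall i, (i <= m)%N -> dot c (X (sg i)) = dot c (X (sg 0%N)) + i%:R.
Proof.
move=> [_ _ sgS]; elim=> [|i IHi] im; first by rewrite addr0.
by rewrite (swap_step_dot (sgS i im)) IHi ?(ltnW im) // -addrA natr1.
Qed.

Lemma swap_step_lt s t x x' : swap_step s t -> (x \in S) = (x' \in S) ->
  (t x < t x')%N = (s x < s x')%N.
Proof.
move=> [a [b [aS bS sab ->]]] xx'; apply: swap_lt => //.
all: apply/negP => /andP[/eqP xE /eqP x'E]; move: xx'.
all: by rewrite xE x'E aS (negPf bS).
Qed.

(** A step only reverses one comparison between [S] and its complement, so both internal orders
    persist. *)
Lemma perm_path_lt m sg x x' : perm_path m sg -> (x \in S) = (x' \in S) ->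
  forall i, (i <= m)%N -> (sg i x < sg i x')%N = (sg 0%N x < sg 0%N x')%N.
Proof.
move=> [_ _ sgS] xx'; elim=> [//|i IHi] im.
by rewrite (swap_step_lt (sgS i im)) // IHi // ltnW.
Qed.

End MonotonePaths.

(** * Entries of standard tableaux *)

Section Tableaux.
Variables (k l : nat).
Implicit Type T : 'M[nat]_(k, l).

Lemma SYT_inj T : SYT k l T -> injective (fun q : 'I_k * 'I_l => T q.1 q.2).
Proof.
case=> perm_T _ _; apply/injectiveP; rewrite /injectiveb /dinjectiveb.
by rewrite (perm_uniq perm_T) iota_uniq.
Qed.

Lemma SYT_image T : SYT k l T -> forall t,
  (0 < t <= k * l)%N <-> exists a b, T a b = t.
Proof.
case=> /perm_mem perm_T _ _ t.
have -> : (0 < t <= k * l)%N = (t \in iota 1 (k * l)).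
  by rewrite mem_iota add1n ltnS.
rewrite -perm_T; split=> [/fintype.imageP[[a b] _ ->]|[a [b <-]]]; first by exists a, b.
by apply/fintype.imageP; exists (a, b).
Qed.

Lemma SYT_eq T a b a' b' : SYT k l T -> T a b = T a' b' -> a = a' /\ b = b'.
Proof. by move=> /SYT_inj inj e; case: (inj (a, b) (a', b') e). Qed.

End Tableaux.

(** * The order of the labels at a given time *)

Section LabelOrder.
Variables (k l : nat) (al : 'S_k) (be : 'S_l) (T : 'M[nat]_(k, l)).

(** [inl] labels the elements of [S], ranked by [al] from the top; [inr] labels the others, ranked
    by [be] from the bottom. A mixed pair is inverted from the time given by [T] on. *)
Definition label_lt (tau : nat) : rel ('I_k + 'I_l) := fun p q =>
  match p, q with
  | inl a, inl a' => (al a' < al a)%N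
  | inr b, inr b' => (be b < be b')%N
  | inl a, inr b => (tau < T (al a) (be b))%N
  | inr b, inl a => (T (al a) (be b) <= tau)%N
  end.

Hypothesis T_SYT : SYT k l T.

Lemma label_ltxx tau : irreflexive (label_lt tau).
Proof. by case=> a /=; rewrite ltnn. Qed.

Lemma label_lt_total tau p q : p != q -> label_lt tau p q || label_lt tau q p.
Proof.
case: p q => [a|b] [a'|b'] /= neq; try by lia.
- have : al a != al a' :> nat by apply: contra neq => /eqP/val_inj/perm_inj ->.
  by lia.
- have : be b != be b' :> nat by apply: contra neq => /eqP/val_inj/perm_inj ->.
  by lia.
Qed.

(** Cases with labels of both kinds follow from the growth of [T] along rows and columns. *)
Lemma label_lt_trans tau : transitive (label_lt tau).
Proof.
have [_ row col] := T_SYT.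
move=> [a|b] [a'|b'] [a''|b''] /=; try by lia.
- by move=> /(col _ _ (be b'')); lia.
- by move=> + /(col _ _ (be b')); lia.
- move=> h1 h2; rewrite ltnNge; apply/negP; rewrite leq_eqVlt.
  by move=> /predU1P[/val_inj e|/(row (al a) _ _)]; [rewrite e in h2; lia | lia].
- move=> h1 h2; rewrite ltnNge; apply/negP; rewrite leq_eqVlt.
  by move=> /predU1P[/val_inj e|/(col _ _ (be b))]; [rewrite e in h1; lia | lia].
- by move=> + /(row (al a') _ _); lia.
- by move=> /(row (al a'') _ _); lia.
Qed.

End LabelOrder.

(** * Paths correspond to triples of two permutations and a tableau *)

Section Labels.
Variables (R : realType) (n k l : nat) (S : {set 'I_n}).
Variables (enc : 'I_k + 'I_l -> 'I_n) (dec : 'I_n -> 'I_k + 'I_l).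
Hypotheses (encK : cancel enc dec) (decK : cancel dec enc).
Hypothesis enc_S : forall q, (enc q \in S) = (if q is inl _ then true else false).
Implicit Types (al : 'S_k) (be : 'S_l) (T : 'M[nat]_(k, l)) (sg : nat -> 'S_n).

Local Notation P := (permutahedron R n).
Local Notation c := (indicator R S).
Local Notation X := (@pvec R n).

Let encl a := enc (inl a).
Let encr b := enc (inr b).

Lemma encl_S a : encl a \in S. Proof. by rewrite enc_S. Qed.
Lemma encr_S b : encr b \notin S. Proof. by rewrite enc_S. Qed.

Lemma in_S x : x \in S -> exists a, x = encl a.
Proof. by rewrite -(decK x) enc_S; case: (dec x) => a // _; exists a. Qed.

Lemma notin_S x : x \notin S -> exists b, x = encr b.
Proof. by rewrite -(decK x) enc_S; case: (dec x) => b // _; exists b. Qed.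

Definition labelled al be T (m : nat) sg :=
  forall tau, (tau <= m)%N -> forall p q,
  (sg tau (enc p) < sg tau (enc q))%N = label_lt al be T tau p q.

(** Ranks in the label order, shifted by one as in [pvec]: an explicit map from triples to paths. *)
Definition label_path al be T : seq 'rV[R]_n :=
  mkseq (fun tau => \row_x
    (#|[pred z | label_lt al be T tau (dec z) (dec x)]|.+1)%:R) (k * l).+1.

Lemma label_pathE al be T : SYT k l T -> exists sg,
  labelled al be T (k * l) sg /\ label_path al be T = mkseq (X \o sg) (k * l).+1.
Proof.
move=> T_SYT.
have /choice[sg sgP] tau : exists s : 'S_n,
    (forall x, s x = #|[pred z | label_lt al be T tau (dec z) (dec x)]| :> nat) /\
    forall x y, (s x < s y)%N = label_lt al be T tau (dec x) (dec y).
  apply: (@rank_perm n (fun x y => label_lt al be T tau (dec x) (dec y))).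
  - by move=> x; apply: label_ltxx.
  - by move=> y x z; apply: label_lt_trans.
  - move=> x y xy; apply: label_lt_total.
    by apply: contra xy => /eqP/(can_inj decK) ->.
exists sg; split=> [tau _ p q|]; first by rewrite (sgP tau).2 !encK.
apply: eq_mkseq => tau; apply/rowP => x.
by rewrite !mxE (sgP tau).1.
Qed.

Lemma labelled_uniq al be T m sg sg' :
    labelled al be T m sg -> labelled al be T m sg' ->
  mkseq (X \o sg) m.+1 = mkseq (X \o sg') m.+1.
Proof.
move=> sgP sgP'; apply/eq_in_map => tau; rewrite mem_iota add0n ltnS => /= tm.
congr pvec; apply: perm_eq_lt => x y.
by rewrite -(decK x) -(decK y) sgP // sgP'.
Qed.

Lemma labelled_step al be T sg tau a b : SYT k l T ->
    labelled al be T (k * l) sg -> T (al a) (be b) = tau.+1 ->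
  sg tau (encr b) = (sg tau (encl a)).+1 :> nat /\
  sg tau.+1 = (tperm (encl a) (encr b) * sg tau)%g.
Proof.
move=> T_SYT sgP Tab; have [_ row col] := T_SYT.
have tkl : (tau < k * l)%N.
  have /(SYT_image T_SYT _).2 : exists i j, T i j = tau.+1 by exists (al a), (be b).
  by case/andP.
have lt_ab : (sg tau (encl a) < sg tau (encr b))%N.
  by rewrite sgP ?(ltnW tkl) //= Tab.
have sab : sg tau (encr b) = (sg tau (encl a)).+1 :> nat.
  (* A label [z] strictly between the two would have an earlier entry in the same row or column,
     hence at most [tau], while its place in the order requires more than [tau]. *)
  apply/eqP; rewrite eqn_leq lt_ab andbT leqNgt; apply/negP => gap.
  have lt_n := ltn_trans gap (ltn_ord _).
  pose z := ((sg tau)^-1)%g (Ordinal lt_n).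
  have sz : sg tau z = (sg tau (encl a)).+1 :> nat by rewrite permKV.
  have : (sg tau (encl a) < sg tau z)%N by rewrite sz.
  have : (sg tau z < sg tau (encr b))%N by rewrite sz.
  rewrite -(decK z); case: (dec z) => [a'|b'].
    rewrite !sgP ?(ltnW tkl) //= => h /(col _ _ (be b)).
    by lia.
  rewrite !sgP ?(ltnW tkl) //= => /(row (al a) _ _) h1 h2.
  by lia.
split=> //; apply/esym/perm_eq_lt => x y.
(* Only the pair with entry [tau.+1] compares differently at times [tau] and [tau.+1], and it is the
   swapped pair. *)
rewrite -(decK x) -(decK y); move: (dec x) (dec y) => p q {x y}.
rewrite sgP //; have [/andP[/eqP pb /eqP qa]|n1] :=
  boolP ((enc p == encr b) && (enc q == encl a)).
  by rewrite (can_inj encK pb) (can_inj encK qa) /= Tab leqnn.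
have [/andP[/eqP pa /eqP qb]|n2] :=
    boolP ((enc p == encl a) && (enc q == encr b)).
  rewrite pa qb !swap_val // !eqxx; case: eqP => [e|_]; last by lia.
  by have := encl_S a; rewrite -e (negPf (encr_S b)).
rewrite swap_lt // sgP ?(ltnW tkl) //.
case: p q n1 n2 => [a'|b'] [a''|b''] //= n1 n2; last by lia.
move=> h; rewrite ltn_neqAle h andbT -Tab; apply/negP => /eqP.
move=> /(SYT_eq T_SYT)[/perm_inj e /perm_inj e'].
by rewrite e e' !eqxx in n2.
Qed.

Lemma labelled_perm_path al be T sg : SYT k l T ->
  labelled al be T (k * l) sg -> perm_path S (k * l) sg.
Proof.
move=> T_SYT sgP; have TP := SYT_image T_SYT.
have bnd i j : (0 < T i j <= k * l)%N by apply/TP; exists i, j.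
split=> [_ _ /in_S[a ->] /notin_S[b ->]|_ _ /in_S[a ->] /notin_S[b ->]|tau tkl].
- by rewrite sgP //=; have := bnd (al a) (be b); lia.
- by rewrite sgP //=; have := bnd (al a) (be b); lia.
have /TP[i [j Tij]] : (0 < tau.+1 <= k * l)%N by [].
rewrite -[i](permKV al) -[j](permKV be) in Tij.
have [sab ->] := labelled_step T_SYT sgP Tij.
exists (encl ((al^-1)%g i)), (encr ((be^-1)%g j)).
by split=> //; rewrite ?encl_S ?encr_S.
Qed.

(** Comparisons of like labels at time 0 recover [al] and [be]; mixed comparisons at times [T i j]
    and [T' i j] give the two inequalities between these entries. *)
Lemma labelled_inj al be T al' be' T' sg : SYT k l T -> SYT k l T' ->
    labelled al be T (k * l) sg -> labelled al' be' T' (k * l) sg ->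
  (al, be, T) = (al', be', T').
Proof.
move=> T_SYT T_SYT' sgP sgP'.
have E tau p q : (tau <= k * l)%N ->
    label_lt al be T tau p q = label_lt al' be' T' tau p q.
  by move=> tkl; rewrite -sgP // sgP'.
have eal : al = al'.
  by apply: perm_eq_lt => a a'; have /= -> := E 0%N (inl a') (inl a) isT.
have ebe : be = be'.
  by apply: perm_eq_lt => b b'; have /= -> := E 0%N (inr b) (inr b') isT.
rewrite -eal -ebe; congr (_, _); apply/matrixP => i j.
have bnd (U : 'M_(k, l)) : SYT k l U -> (U i j <= k * l)%N.
  move=> /SYT_image/(_ (U i j)) UP.
  by have /UP/andP[] : exists a b, U a b = U i j by exists i, j.
have := E (T i j) (inl ((al^-1)%g i)) (inr ((be^-1)%g j)) (bnd _ T_SYT).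
have := E (T' i j) (inl ((al^-1)%g i)) (inr ((be^-1)%g j)) (bnd _ T_SYT').
by rewrite /= -eal -ebe !permKV !ltnn; lia.
Qed.

(** The entry of a pair is the time from which it is inverted. Each step inverts one new pair and
    undoes none, so these times run bijectively over 1 to [m], which also determines [m]. *)
Lemma perm_path_labelled m sg : perm_path S m sg ->
  exists al be T, [/\ SYT k l T, m = (k * l)%N & labelled al be T m sg].
Proof.
move=> sgP; have [sg0 sgm sgS] := sgP.
have [al alP] : exists s : 'S_k, forall a a',
    (s a < s a')%N = (sg 0%N (encl a') < sg 0%N (encl a))%N.
  have [||| s [_ sP]] := @rank_perm k
    (fun a a' => sg 0%N (encl a') < sg 0%N (encl a))%N; last by exists s.
  - by move=> a; rewrite ltnn.
  - by move=> a' a a'' h1 h2; apply: ltn_trans h2 h1.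
  move=> a a' neq; have : sg 0%N (encl a) != sg 0%N (encl a') :> nat.
    by apply: contra neq => /eqP/val_inj/perm_inj/(can_inj encK)[->].
  by lia.
have [be beP] : exists s : 'S_l, forall b b',
    (s b < s b')%N = (sg 0%N (encr b) < sg 0%N (encr b'))%N.
  have [||| s [_ sP]] := @rank_perm l
    (fun b b' => sg 0%N (encr b) < sg 0%N (encr b'))%N; last by exists s.
  - by move=> b; rewrite ltnn.
  - by move=> b' b b'' h1 h2; apply: ltn_trans h1 h2.
  move=> b b' neq; have : sg 0%N (encr b) != sg 0%N (encr b') :> nat.
    by apply: contra neq => /eqP/val_inj/perm_inj/(can_inj encK)[->].
  by lia.
have stepP i : (i < m)%N -> exists a b,
    ~~ (sg i (encr b) < sg i (encl a))%N /\
    forall a' b', (sg i.+1 (encr b') < sg i.+1 (encl a'))%N =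
    (sg i (encr b') < sg i (encl a'))%N || ((a', b') == (a, b)).
  move=> /sgS[x [y [/in_S[a ->] /notin_S[b ->] sab ->]]]; exists a, b.
  split=> [|a' b']; first by rewrite -leqNgt sab.
  have ab p q : (encr p == encl q) = false.
    by apply/negP => /eqP e; have := encl_S q; rewrite -e (negPf (encr_S p)).
  case: eqP => [[-> ->]|neq].
    by rewrite orbT !swap_val // ab !eqxx sab ltnSn.
  rewrite orbF swap_lt // ?ab //.
  apply/negP => /andP[/eqP/(can_inj encK)[e] /eqP/(can_inj encK)[e']].
  by case: neq; rewrite e e'.
have crossing (q : 'I_k * 'I_l) : exists t, (0 < t <= m)%N /\
    forall i, (i <= m)%N -> (sg i (encr q.2) < sg i (encl q.1))%N = (t <= i)%N.
  pose inv i := (sg i (encr q.2) < sg i (encl q.1))%N.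
  have inv_m : inv m by apply: sgm; rewrite ?encl_S ?encr_S.
  have inv_mono d i : (i + d <= m)%N -> inv i -> inv (i + d)%N.
    elim: d => [|d IHd] idm invi; first by rewrite addn0.
    rewrite addnS in idm *; have [a [b [_]]] := stepP _ idm.
    by move=> /(_ q.1 q.2); rewrite -/(inv _) -/(inv _) => ->; rewrite IHd // ltnW.
  (* The least time of inversion is a threshold, since inversions persist. *)
  case: (ex_minnP (ex_intro inv m inv_m)) => t inv_t tmin.
  exists t; split=> [|i im]; last first.
    apply/idP/idP => [/tmin//|ti].
    by have := inv_mono (i - t)%N t; rewrite subnKC //; apply.
  rewrite tmin // andbT lt0n; apply/eqP => t0.
  have : (sg 0%N (encl q.1) < sg 0%N (encr q.2))%N.
    by apply: sg0; rewrite ?encl_S ?encr_S.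
  by move: inv_t; rewrite t0 /inv; lia.
(* [F] is indexed by labels but [T] by their ranks, hence the inverse permutations below. *)
have [F FP] := choice crossing.
pose T : 'M[nat]_(k, l) := \matrix_(i, j) F ((al^-1)%g i, (be^-1)%g j).
have TE a b : T (al a) (be b) = F (a, b) by rewrite mxE !permK.
have F_inj : injective F.
  move=> q q' Fqq'; have [/andP[F0 Fm] Fq] := FP q; have [_ Fq'] := FP q'.
  have tm : (F q).-1.+1 = F q by apply: prednK.
  (* Both pairs become inverted in the step ending at time [F q], which inverts only one. *)
  have [|a [b [_ ab]]] := stepP (F q).-1; first by rewrite tm.
  have := ab q.1 q.2; have := ab q'.1 q'.2.
  have hm : ((F q).-1 <= m)%N by rewrite (leq_trans (leq_pred _)).
  rewrite tm !Fq // !Fq' // -Fqq' leqnn.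
  have -> /= : (F q <= (F q).-1)%N = false by lia.
  by rewrite -!surjective_pairing => /esym/eqP -> /esym/eqP ->.
have F_surj i : (i < m)%N -> exists q, F q = i.+1.
  move=> im; have [a [b [nab ab]]] := stepP i im; exists (a, b).
  have [/andP[F0 Fm] Fab] := FP (a, b).
  have := ab a b; rewrite eqxx orbT => h1.
  have := Fab i.+1 im; rewrite h1 => /esym F1.
  by move: nab; rewrite (Fab i (ltnW im)); lia.
have permF : perm_eq [seq T q.1 q.2 | q : 'I_k * 'I_l] (iota 1 m).
  apply: uniq_perm; last 1 first.
  - move=> t; rewrite mem_iota add1n ltnS; apply/fintype.imageP/idP.
      by move=> [q _ ->]; rewrite mxE; case: (FP ((al^-1)%g q.1, (be^-1)%g q.2)).
    case: t => // t /F_surj[q Fq].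
    by exists (al q.1, be q.2); rewrite //= TE -Fq; case: q {Fq}.
  - rewrite map_inj_uniq ?enum_uniq // => -[a b] [a' b'] /=.
    by rewrite !mxE => /F_inj[/perm_inj -> /perm_inj ->].
  exact: iota_uniq.
have mE : m = (k * l)%N.
  by have := perm_size permF; rewrite size_iota size_map -cardE card_prod !card_ord.
exists al, be, T; split=> //.
  have lt_neq q q' : (F q <= F q')%N -> q != q' -> (F q < F q')%N.
    by move=> le neq; rewrite ltn_neqAle le andbT; apply: contra neq => /eqP/F_inj ->.
  split; first by rewrite -mE.
    move=> i j j' jj'; rewrite !mxE; set a := (al^-1)%g i.
    rewrite -[j](permKV be) -[j'](permKV be) beP in jj'.
    move: ((be^-1)%g j) ((be^-1)%g j') jj' => b b' bb'.
    have [[_ Fab] [/andP[_ Fm] Fab']] := (FP (a, b), FP (a, b')).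
    apply: lt_neq; last by apply: contraTneq bb' => -[->]; rewrite ltnn.
    (* At time [F (a, b')], [b] is below [b'] and [b'] below [a], so [(a, b)] is already inverted.
       Columns are treated likewise. *)
    rewrite -Fab //=; apply: (@ltn_trans (sg (F (a, b')) (encr b'))).
      by rewrite (perm_path_lt sgP) // !enc_S.
    by have := Fab' _ Fm; rewrite leqnn.
  move=> i i' j ii'; rewrite !mxE; set b := (be^-1)%g j.
  rewrite -[i](permKV al) -[i'](permKV al) alP in ii'.
  move: ((al^-1)%g i) ((al^-1)%g i') ii' => a a' aa'.
  have [[_ Fab] [/andP[_ Fm] Fab']] := (FP (a, b), FP (a', b)).
  apply: lt_neq; last by apply: contraTneq aa' => -[->]; rewrite ltnn.
  rewrite -Fab //=; apply: (@ltn_trans (sg (F (a', b)) (encl a'))).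
    by have := Fab' _ Fm; rewrite leqnn.
  by rewrite (perm_path_lt sgP) // !enc_S.
move=> tau tm [a|b] [a'|b'] /=.
- by rewrite alP (perm_path_lt sgP) // !enc_S.
- have [_ Fab] := FP (a, b'); rewrite TE [RHS]ltnNge -Fab //= -leqNgt [RHS]leq_eqVlt.
  case: eqP => [/val_inj/perm_inj/(can_inj encK)//|_]; done.
- by have [_ Fab] := FP (a', b); rewrite TE -Fab.
- by rewrite beP (perm_path_lt sgP) // !enc_S.
Qed.

End Labels.

(** * Coherent paths and realizable tableaux *)

Lemma SYT_card (k l : nat) (T : 'M[nat]_(k, l)) t :
    SYT k l T -> (t <= k * l)%N ->
  #|[pred q : 'I_k * 'I_l | (T q.1 q.2 <= t)%N]| = t.
Proof.
move=> [perm_T _ _] tkl; rewrite cardE /enum_mem size_filter.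
rewrite (_ : count _ _ = count (leq^~ t) [seq T q.1 q.2 | q : 'I_k * 'I_l]); last first.
  by rewrite /image_mem enumT count_map.
rewrite (seq.permP perm_T) -[in iota _ _](subnKC tkl) iotaD count_cat.
rewrite (@eq_in_count _ _ predT (iota 1 t)); last first.
  by move=> i; rewrite mem_iota /=; lia.
rewrite (@eq_in_count _ _ pred0 (iota (1 + t) _)); last first.
  by move=> i; rewrite mem_iota /=; lia.
by rewrite count_predT count_pred0 size_iota addn0.
Qed.

(** Used to find the step of a path whose range of [c] contains a given value. *)
Lemma unit_interval_of (R : realType) (m : nat) (r : R) :
  (0 < m)%N -> 0 <= r <= m%:R -> exists2 i, (i < m)%N & i%:R <= r <= i.+1%:R.
Proof.
elim: m => // m IHm _ /andP[r0 rm]; case: (leP m%:R r) => [mr|/ltW rm'].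
  by exists m; rewrite ?mr.
case: m IHm rm rm' => [|m] IHm rm rm'; first by exists 0%N; rewrite ?r0.
by have [||i im ir] := IHm; [|rewrite r0|exists i => //; rewrite ltnW].
Qed.

Section Coherence.
Variables (R : realType) (n k l : nat) (S : {set 'I_n}).
Variables (enc : 'I_k + 'I_l -> 'I_n) (dec : 'I_n -> 'I_k + 'I_l).
Hypotheses (encK : cancel enc dec) (decK : cancel dec enc).
Hypothesis enc_S : forall q, (enc q \in S) = (if q is inl _ then true else false).
Hypotheses (k_gt0 : (0 < k)%N) (l_gt0 : (0 < l)%N).
Variables (al : 'S_k) (be : 'S_l) (T : 'M[nat]_(k, l)) (sg : nat -> 'S_n).
Hypotheses (T_SYT : SYT k l T) (sgP : labelled enc al be T (k * l) sg).

Local Notation P := (permutahedron R n).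
Local Notation c := (indicator R S).
Local Notation X := (@pvec R n).
Local Notation p := (mkseq (X \o sg) (k * l).+1).

Let nthX i : (i <= k * l)%N -> nth 0 p i = X (sg i).
Proof. by move=> im; rewrite nth_mkseq. Qed.

Let sg_path : perm_path S (k * l) sg.
Proof. exact: labelled_perm_path sgP. Qed.

Let cX i : (i <= k * l)%N -> dot c (X (sg i)) = dot c (X (sg 0%N)) + i%:R.
Proof. exact: perm_path_dot. Qed.

Let T_gt0 i j : (0 < T i j)%N.
Proof.
have /(SYT_image T_SYT) : exists i' j', T i' j' = T i j by exists i, j.
by case/andP.
Qed.

Let T_le i j : (T i j <= k * l)%N.
Proof.
have /(SYT_image T_SYT) : exists i' j', T i' j' = T i j by exists i, j.
by case/andP.
Qed.

(* If the path failed to be strictly concave at [sg tau.+1], the midpoint of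
   its two neighbours would lie on or above it in the projection. *)
Lemma coherent_concave (w : 'rV[R]_n) tau :
    upper_boundary (plane_proj c w @` P) =
      \bigcup_(i in [set i | (i.+1 < size p)%N])
        (plane_proj c w @` segment (nth 0 p i) (nth 0 p i.+1)) ->
    (forall i, (i.+1 < size p)%N ->
      [set x | P x /\ (plane_proj c w @` segment (nth 0 p i) (nth 0 p i.+1))
        (plane_proj c w x)] = segment (nth 0 p i) (nth 0 p i.+1)) ->
    (tau.+2 <= k * l)%N ->
  dot w (X (sg tau)) - dot w (X (sg tau.+1)) <
  dot w (X (sg tau.+1)) - dot w (X (sg tau.+2)).
Proof.
rewrite size_mkseq => up uniq_pre tkl; rewrite ltNge; apply/negP => conv_tau.
have tkl1 := ltnW tkl; have tkl0 := ltnW tkl1.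
have c1 : dot c (X (sg tau.+1)) = dot c (X (sg tau)) + 1.
  by rewrite (cX tkl1) (cX tkl0) -natr1 addrA.
have c2 : dot c (X (sg tau.+2)) = dot c (X (sg tau)) + 1 + 1.
  by rewrite -c1 (cX tkl) (cX tkl1) -[in LHS]natr1 addrA.
pose M := (1 - 2^-1) *: X (sg tau) + 2^-1 *: X (sg tau.+2).
have M_seg : segment (X (sg tau)) (X (sg tau.+2)) M.
  by exists 2^-1; split=> //; lra.
have PM : P M by apply: segment_permutahedron M_seg; apply: permutahedron_pvec.
have cM : dot c M = dot c (X (sg tau.+1)).
  by rewrite dotDr !dotZr c1 c2; lra.
have X_seg : segment (nth 0 p tau) (nth 0 p tau.+1) (X (sg tau.+1)).
  by rewrite (nthX tkl1); apply: segment_r.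
have : upper_boundary (plane_proj c w @` P) (plane_proj c w (X (sg tau.+1))).
  by rewrite up; exists tau => //; exists (X (sg tau.+1)).
move=> [_ /= above].
have wM : dot w M = dot w (X (sg tau.+1)).
  have le_wM : dot w (X (sg tau.+1)) <= dot w M.
    by rewrite dotDr !dotZr; lra.
  apply/eqP; rewrite eq_le le_wM andbT leNgt; apply/negP => lt_wM.
  apply: (above (dot w M - dot w (X (sg tau.+1)))); first by rewrite subr_gt0.
  by exists M => //; rewrite /plane_proj cM addrC subrK.
(* [M] projects to a point of the first edge, so it lies on that edge, and its [c]-value makes it
   the end [X (sg tau.+1)]. This vertex would then be one of its own neighbours, by
   [pvec_segment]. *)
have : segment (nth 0 p tau) (nth 0 p tau.+1) M.
  rewrite -uniq_pre //; split=> //; exists (X (sg tau.+1)) => //.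
  by rewrite /plane_proj cM wM.
rewrite (nthX tkl0) (nthX tkl1) => -[h [_ Mh]].
have h1 : h = 1.
  have := congr1 (dot c) Mh; rewrite cM dotDr !dotZr c1.
  by move=> e; lra.
have M_X : M = X (sg tau.+1) by rewrite Mh h1 subrr scale0r scale1r add0r.
move: M_seg; rewrite M_X => /pvec_segment[] e.
  by move: c1; rewrite e; lra.
by move: c2; rewrite -e c1; lra.
Qed.

Lemma coherent_realizable : coherent P c p -> realizable R T.
Proof.
move=> [w [up uniq_pre]].
pose d tau := dot w (X (sg tau)) - dot w (X (sg tau.+1)).
have d_mono t t' : (t < t')%N -> (t' < k * l)%N -> d t < d t'.
  elim: t' => // t' IHt tt' tkl.
  have step := coherent_concave up uniq_pre tkl.
  move: tt'; rewrite ltnS leq_eqVlt => /predU1P[->//|tt'].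
  by apply: lt_trans step; apply: IHt => //; apply: ltnW.
pose u i := - w 0 (enc (inl ((al^-1)%g i))).
pose v j := w 0 (enc (inr ((be^-1)%g j))).
(* [dot_swap] computes the drop of [w] across the step that ends at time [T i j]. *)
have uvE i j : u i + v j = d (T i j).-1.
  have Tij : T (al ((al^-1)%g i)) (be ((be^-1)%g j)) = (T i j).-1.+1.
    by rewrite !permKV prednK.
  have [sab sE] := labelled_step encK decK enc_S T_SYT sgP Tij.
  by rewrite /d sE dot_swap sab -natr1 /u /v; ring.
have uv_lt i j i' j' : (T i j < T i' j')%N -> u i + v j < u i' + v j'.
  move=> lt_T; rewrite !uvE; apply: d_mono.
    by have := T_gt0 i j; lia.
  by have := T_le i' j'; have := T_gt0 i' j'; lia.
have uv_le i j i' j' : (u i + v j <= u i' + v j') = (T i j <= T i' j')%N.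
  apply/idP/idP => [|]; first by apply: contraTT; rewrite -ltnNge -ltNge => /uv_lt.
  rewrite leq_eqVlt => /predU1P[/(SYT_eq T_SYT)[-> ->] //|/uv_lt/ltW//].
have [_ row col] := T_SYT.
exists u, v; split.
(* Column 0 exists because [l] is positive; row 0 is used likewise for [v]. *)
- by move=> i i' /(col _ _ (Ordinal l_gt0))/uv_lt; rewrite ltrD2r.
- by move=> j j' /(row (Ordinal k_gt0))/uv_lt; rewrite ltrD2l.
- move=> [i j] [i' j'] /= e; apply: (SYT_inj T_SYT) => /=.
  by apply/eqP; rewrite eqn_leq -!uv_le e lexx.
move=> i j; rewrite -[LHS](SYT_card T_SYT (T_le i j)).
by apply: eq_card => q; rewrite !inE uv_le.
Qed.

(* The functionals [w + theta c], for increasing [theta], expose the steps of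
   the path one after the other. *)
Lemma realizable_exposed : realizable R T -> exists w : 'rV[R]_n,
  forall tau, (tau < k * l)%N -> exists theta,
    (forall x, P x -> dot (w + theta *: c) x <= dot (w + theta *: c) (X (sg tau))) /\
    [set x | P x /\ dot (w + theta *: c) x = dot (w + theta *: c) (X (sg tau))] =
      segment (X (sg tau)) (X (sg tau.+1)).
Proof.
move=> [u [v [u_lt v_lt uv_inj uvT]]].
have T_lt i j i' j' : (T i j < T i' j')%N -> u i + v j < u i' + v j'.
  move=> lt_T; rewrite ltNge; apply: contraTN lt_T => le_uv.
  rewrite -leqNgt !uvT; apply: subset_leq_card; apply/fintype.subsetP => q.
  by rewrite !inE => /le_trans; apply.
pose w : 'rV[R]_n := \row_x match dec x with
  | inl a => - u (al a) | inr b => v (be b) end.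
have wl a : w 0 (enc (inl a)) = - u (al a) by rewrite mxE encK.
have wr b : w 0 (enc (inr b)) = v (be b) by rewrite mxE encK.
exists w => tau tkl.
have /(SYT_image T_SYT)[i [j Tij]] : (0 < tau.+1 <= k * l)%N by [].
rewrite -[i](permKV al) -[j](permKV be) in Tij.
move: ((al^-1)%g i) ((be^-1)%g j) Tij => a b Tab {i j}.
pose theta := u (al a) + v (be b); exists theta.
have fl a' : (w + theta *: c) 0 (enc (inl a')) = theta - u (al a').
  by rewrite mxE wl !mxE enc_S mulr1 addrC.
have fr b' : (w + theta *: c) 0 (enc (inr b')) = v (be b').
  by rewrite mxE wr !mxE enc_S mulr0 addr0.
have [sab sE] := labelled_step encK decK enc_S T_SYT sgP Tab.
have [||f_sorted f_face] := swap_face (a := w + theta *: c) sab.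
- by rewrite fl fr /theta; ring.
(* Pairs with entry at most [tau] have sum below [theta], those with entry above [tau.+1] have sum
   above it; so the only tie is at [tau.+1]. *)
- move=> z z'; rewrite -(decK z) -(decK z'); move: (dec z) (dec z') => q q' {z z'}.
  rewrite sgP ?(ltnW tkl) //; case: q q' => [a'|b'] [a''|b''] /=.
  + by move=> /u_lt; rewrite !fl => ?; left; lra.
  + rewrite leq_eqVlt -Tab => /predU1P[/(SYT_eq T_SYT)[/perm_inj-> /perm_inj->]|].
      by right.
    by move=> /T_lt; rewrite fl fr /theta => ?; left; lra.
  + rewrite -ltnS -Tab => /T_lt; rewrite fl fr /theta => ?; left; lra.
  by move=> /v_lt; rewrite !fr; left.
by split; [apply/sorted_maxP | rewrite f_face sE].
Qed.

Lemma realizable_coherent : realizable R T -> coherent P c p.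
Proof.
move=> /realizable_exposed[w wP]; exists w; rewrite size_mkseq.
have kl_gt0 : (0 < k * l)%N by rewrite muln_gt0 k_gt0.
have [sg0 sgm _] := sg_path.
have fE (theta : R) x : dot (w + theta *: c) x = dot w x + theta * dot c x.
  by rewrite dotDl dotZl.
split; last first.
  move=> i; rewrite ltnS => ikl; rewrite (nthX ikl) (nthX (ltnW ikl)).
  have [theta [fmax fface]] := wP i ikl.
  (* Points with equal projections have equal values under [w + theta *: c], hence lie on the same
     exposed face. *)
  apply/seteqP; split=> [x [Px [z]]|x xseg].
    rewrite -fface => -[Pz fz] [cz wz]; split=> //.
    by rewrite -fz !fE cz wz.
  split; last by exists x.
  by apply: segment_permutahedron xseg; apply: permutahedron_pvec.
apply/seteqP; split=> [_ [[x Px <-] above]|st [i]]; last first.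
  move=> ilt; have ikl : (i < k * l)%N := ilt.
  move=> [x]; rewrite (nthX ikl) (nthX (ltnW ikl)).
  have [theta [fmax fface]] := wP i ikl; rewrite -fface => -[Px fx] <-.
  split=> [|e e_gt0 /= [y Py [cy wy]]]; first by exists x.
  by have := fmax y Py; rewrite -fx !fE cy wy; lra.
(* Along the path [c] climbs by unit steps from its minimum to its maximum on [P]. *)
have [|i ikl ir] := @unit_interval_of R _ (dot c x - dot c (X (sg 0%N))) kl_gt0.
  have [_ /(_ x Px) le_x] := (minface_pvec R S (sg 0%N)).2 sg0.
  have [_ /(_ x Px) x_le] := (maxface_pvec R S (sg (k * l)%N)).2 sgm.
  by move: x_le; rewrite (cX (leqnn _)); lra.
exists i; first by [].
rewrite (nthX ikl) (nthX (ltnW ikl)).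
have [theta [fmax fface]] := wP i ikl.
pose h := dot c x - dot c (X (sg i)).
(* [z] is the point of the edge at the [c]-height of [x]. Exposure gives [dot w x <= dot w z], and
   strictness would contradict [x] projecting to the upper boundary. *)
pose z := (1 - h) *: X (sg i) + h *: X (sg i.+1).
have z_seg : segment (X (sg i)) (X (sg i.+1)) z.
  by exists h; split=> //; rewrite /h (cX (ltnW ikl)); move: ir; rewrite -natr1; lra.
have cz : dot c z = dot c x.
  by rewrite dotDr !dotZr (cX ikl) -natr1 addrA -(cX (ltnW ikl)) /h; ring.
have [Pz fz] : P z /\ dot (w + theta *: c) z = dot (w + theta *: c) (X (sg i)).
  by move: z_seg; rewrite -fface.
exists z => //; rewrite /plane_proj cz; congr (_, _).
have := fmax x Px; rewrite -fz !fE cz lerD2r => le_w.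
apply/eqP; rewrite eq_le le_w andbT leNgt; apply/negP => lt_w.
apply: (above (dot w z - dot w x)); first by rewrite subr_gt0.
by exists z => //; rewrite /plane_proj cz addrC subrK.
Qed.

End Coherence.

(** * Labels for [S] and its complement, and the bijection *)

Lemma exists_labels (n : nat) (S : {set 'I_n}) :
  exists (enc : 'I_#|S| + 'I_(n - #|S|) -> 'I_n) dec,
    [/\ cancel enc dec, cancel dec enc
      & forall q, (enc q \in S) = (if q is inl _ then true else false)].
Proof.
have cardC : (n - #|S|)%N = #|~: S|.
  by rewrite -[X in (X - _)%N](card_ord n) -(cardsC S) addKn.
pose enc (q : 'I_#|S| + 'I_(n - #|S|)) := match q with
  | inl a => enum_val a | inr b => enum_val (cast_ord cardC b) end.
have enc_S q : (enc q \in S) = (if q is inl _ then true else false).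
  case: q => a /=; first exact: enum_valP.
  by have := enum_valP (cast_ord cardC a); rewrite finset.inE => /negPf.
have enc_inj : injective enc.
  move=> q q' e; have := enc_S q; rewrite e enc_S.
  case: q q' e => [a|b] [a'|b'] //= /enum_val_inj; first by move=> ->.
  by move=> /cast_ord_inj ->.
have [|dec encK decK] := inj_card_bij enc_inj.
  by rewrite card_sum !card_ord subnKC // -[X in (_ <= X)%N](card_ord n) max_card.
by exists enc, dec.
Qed.

Theorem theoremE (R : realType) (n : nat) (S : {set 'I_n}) (k : nat)
    (hn : (2 <= n)%N) (hS : #|S| = k) (hk1 : (1 <= k)%N) (hkn : (k <= n - 1)%N) :
  exists f : seq 'rV[R]_n -> 'S_k * 'S_(n - k) * 'M[nat]_(k, n - k),
    set_bij
      [set p | monotone_path (permutahedron R n) (indicator R S) p]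
      ([set: 'S_k] `*` [set: 'S_(n - k)] `*` SYT k (n - k)) f /\
    forall p : seq 'rV[R]_n,
      monotone_path (permutahedron R n) (indicator R S) p ->
      (coherent (permutahedron R n) (indicator R S) p <->
       ([set: 'S_k] `*` [set: 'S_(n - k)] `*` rSYT R k (n - k)) (f p)).
Proof.
subst k; set k := #|S|; set l := (n - k)%N.
have l_gt0 : (0 < l)%N by rewrite /l; lia.
have [enc [dec [encK decK enc_S]]] := exists_labels S.
(* The explicit map goes from triples to paths; the required [f] is its inverse. *)
pose g (q : 'S_k * 'S_l * 'M[nat]_(k, l)) := label_path R dec q.1.1 q.1.2 q.2.
set A := [set p | _]; set B := _ `*` SYT k l.
have g_bij : set_bij B A g.
  split=> [[[al be] T] [_ /= T_SYT]| |p Ap].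
  - have [sg [sgP gE]] := label_pathE R encK decK al be T_SYT.
    apply/monotone_pathP; exists (k * l)%N, sg; split; first exact: gE.
    exact: labelled_perm_path sgP.
  - move=> [[al be] T] [[al' be'] T'] /set_mem[_ /= T_SYT] /set_mem[_ /= T_SYT'].
    have [sg [sgP gE]] := label_pathE R encK decK al be T_SYT.
    have [sg' [sgP' gE']] := label_pathE R encK decK al' be' T_SYT'.
    rewrite /g /= gE gE' => /eq_in_map sgE.
    apply: (labelled_inj T_SYT T_SYT' sgP) => tau tkl q q'.
    by rewrite (pvec_inj (sgE tau _)) ?sgP' // mem_iota.
  have /monotone_pathP[m [sg [pE sg_path]]] :
      monotone_path (permutahedron R n) (indicator R S) p := Ap.
  rewrite pE; move: (perm_path_labelled encK decK enc_S sg_path).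
  move=> [al [be [T [T_SYT mE sgP]]]]; subst m; exists (al, be, T); first by [].
  have [sg' [sgP' gE]] := label_pathE R encK decK al be T_SYT.
  by rewrite /g gE; apply: labelled_uniq sgP' sgP.
(* The default triple is taken only outside [A], the image of [B] under [g]. *)
pose f := 'pinv_(fun=> (1%g, 1%g, 0 : 'M[nat]_(k, l))) B g.
exists f; have f_bij : set_bij A B f by apply: bijpinv_bij.
split=> // p Ap; have gf : g (f p) = p.
  have [_ _ g_surj] := g_bij.
  by apply: (surjpK _ g_surj); rewrite inE.
have [f_fun _ _] := f_bij; have := f_fun p Ap.
move: gf; case: (f p) => [[al be] T] <- [_ /= T_SYT].
have [sg [sgP gE]] := label_pathE R encK decK al be T_SYT.
rewrite /g /= gE; split=> [co|[_ [_ real_T]]].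
  split=> //; split=> //.
  exact: (coherent_realizable encK decK enc_S hk1 l_gt0 T_SYT sgP co).
exact: (realizable_coherent encK decK enc_S hk1 l_gt0 T_SYT sgP real_T).
Qed.
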